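(* For every rooted tree $(T,r)$ and every integer $t\ge 1$, there exists an integer $C$ (depending only on $(T,r)$ and $t$) such that every graph $G$ with no path-induced copy of $(T,r)$ and with no clique of size $t$ satisfies $\chi(G)\le C$.
   Context: Graphs are finite and simple, and $\chi(G)$ denotes the chromatic number of $G$. A rooted tree $(T,r)$ is a tree $T$ together with a vertex $r$ of $T$. A path-induced copy of $(T,r)$ in a graph $G$ is an isomorphism $\phi$ from $T$ to a (not necessarily induced) subgraph of $G$ such that for every path $P$ of $T$ with one end $r$, the image of $P$ under $\phi$ is an induced path in $G$. A clique of size $t$ is a set of $t$ pairwise adjacent vertices. *)

(* Defs.v *)
From mathcomp Require Import all_boot.

Set Implicit Arguments.
Unset Strict Implicit.
Unset Printing Implicit Defensive.

Record sgraph := SGraph {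
  vertex :> finType;
  adj : rel vertex;
  adj_sym : symmetric adj;
  adj_irrefl : irreflexive adj }.

Definition connected (G : sgraph) : Prop :=
  0 < #|G| /\ forall x y : G, connect (@adj G) x y.

(* The bound on the size excludes [:: x; y] with x, y adjacent, which is a
   [cycle] in the sense of the path library. *)
Definition acyclic (G : sgraph) : Prop :=
  forall c : seq G, 2 < size c -> ~ ucycle (@adj G) c.

Definition is_tree (G : sgraph) : Prop := connected G /\ acyclic G.

(* The path whose successive vertices are those of x :: p; x is one end. *)
Definition is_path (G : sgraph) (x : G) (p : seq G) : Prop :=
  path (@adj G) x p /\ uniq (x :: p).

Definition is_induced_path (G : sgraph) (x : G) (p : seq G) : Prop :=
  is_path x p /\
  forall i j : nat, i < j < size (x :: p) ->
    adj (nth x (x :: p) i) (nth x (x :: p) j) -> j = i.+1.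

(* An isomorphism from T to a (not necessarily induced) subgraph of G is given
   by an injective map on vertices sending edges to edges; the subgraph is then
   the image of T. *)
Definition path_induced_copy (T : sgraph) (r : T) (G : sgraph) (phi : T -> G)
    : Prop :=
  [/\ injective phi,
      forall x y : T, adj x y -> adj (phi x) (phi y)
    & forall p : seq T, is_path r p -> is_induced_path (phi r) (map phi p)].

Definition is_clique (G : sgraph) (A : {set G}) : Prop :=
  {in A &, forall x y : G, x != y -> adj x y}.

Definition colorable (G : sgraph) (k : nat) : bool :=
  [exists f : {ffun G -> 'I_k},
    [forall x : G, forall y : G, adj x y ==> (f x != f y)]].

Lemma colorable_exists (G : sgraph) : exists k : nat, colorable G k.
Proof.
exists #|G|; apply/existsP; exists [ffun x => enum_rank x].
apply/forallP=> x; apply/forallP=> y; apply/implyP=> xy.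
rewrite !ffunE; apply/eqP=> /enum_rank_inj exy.
by rewrite exy adj_irrefl in xy.
Qed.

Definition chromatic_number (G : sgraph) : nat := ex_minn (colorable_exists G).

(* Main.v *)
Require Import Defs.
From mathcomp Require Import all_boot.
From mathcomp Require Import zify.

Set Implicit Arguments.
Unset Strict Implicit.
Unset Printing Implicit Defensive.

(** It suffices to find a vertex x that is "good": the root of an m-ary tree of
    depth d in which nobody is adjacent to a non-parent proper ancestor (siblings
    may share descendants; T is then embedded greedily, by induction on the
    number of embedded vertices).

    The induction on d works for a stronger statement: given any ranking pi
    whose fibres, like all neighbourhoods, have bounded chromatic number, some x
    is good with all its descendants ranked above x.  If no x is good for d+1,
    each v has fewer than m later neighbours y that are good for d away from the
    neighbours of v; joining v to these gives a degenerate graph, so the vertices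
    split into m classes without such pairs.  In a class, let p(y) be the first
    neighbour of y in a linear order refining pi.  The fibres of p lie in
    neighbourhoods, so the induction hypothesis applies to the ranking by p: it
    gives y good for d with all descendants z satisfying p(z) > p(y).  Hence p(y)
    is adjacent to none of them, and (p(y), y) is a forbidden pair.

    Neighbourhoods have bounded chromatic number by induction on the clique
    number. *)

(** * Colouring vertex sets without good vertices *)

Section Colouring.

Variable G : sgraph.
Implicit Types (S U : {set G}) (x y v w : G).

Definition nbh v : {set G} := [set y | adj v y].
Definition closed_nbh v : {set G} := v |: nbh v.

Definition colorable_on S k :=
  exists f : G -> nat, {in S, forall x, f x < k} /\
    {in S &, forall x y, adj x y -> f x != f y}.

Lemma colorable_on_sub S S' k :
  S \subset S' -> colorable_on S' k -> colorable_on S k.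
Proof.
move=> /subsetP sS [f [fk fP]]; exists f; split=> [x /sS|x y /sS xS /sS yS].
  exact: fk.
exact: fP.
Qed.

Lemma colorable_on0 k : colorable_on set0 k.
Proof. by exists (fun=> 0); split=> [x|x y]; rewrite inE. Qed.

Lemma colorable_onU S S' k k' :
  colorable_on S k -> colorable_on S' k' -> colorable_on (S :|: S') (k + k').
Proof.
move=> [f [fk fP]] [f' [fk' fP']].
exists (fun x => if x \in S then f x else k + f' x); split=> [x|x y].
  rewrite inE; case: ifP => [xS _|_ /= xS'].
    exact: ltn_addr (fk x xS).
  by rewrite ltn_add2l fk'.
rewrite !inE; case: ifP => [xS|_] /=; case: ifP => [yS|_] //= xS' yS' xy.
- exact: fP.
- by have := fk x xS; lia.
- by have := fk y yS; lia.
- by rewrite eqn_add2l fP'.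
Qed.

(** A class and a colour inside that class are encoded together in base [k]. *)
Lemma colorable_on_classes S (g : G -> nat) m k :
    {in S, forall x, g x < m} ->
    (forall i, i < m -> colorable_on (S :&: [set x | g x == i]) k) ->
  colorable_on S (m * k).
Proof.
move=> gm colg.
have /fin_all_exists[f fP] := fun i : 'I_m => colg i (ltn_ord i).
pose F x := if insub (g x) is Some i then f i x else 0.
have FE x (xS : x \in S) : F x = f (Ordinal (gm x xS)) x.
  by rewrite /F (insubT (fun i => i < m) (gm x xS)).
have Fk x : x \in S -> F x < k.
  by move=> xS; rewrite FE; apply: (fP _).1; rewrite !inE xS /=.
exists (fun x => g x * k + F x); split=> [x xS|x y xS yS xy].
  by have := gm x xS; have := Fk x xS; nia.
have [gxy|] := eqVneq (g x) (g y).
  rewrite gxy eqn_add2l (FE x xS) (FE y yS).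
  have ->: Ordinal (gm x xS) = Ordinal (gm y yS) by apply: val_inj.
  by apply: (fP _).2 => //; rewrite !inE /= ?gxy ?xS ?yS /=.
by have := Fk x xS; have := Fk y yS; nia.
Qed.

(** No edge joins two fibres, so all fibres can share one palette of [k] colours. *)
Lemma colorable_on_fibres S (g : G -> nat) k :
    (forall n, colorable_on (S :&: [set x | g x == n]) k) ->
    {in S &, forall x y, adj x y -> g x = g y} ->
  colorable_on S k.
Proof.
move=> colg gE; pose N := (\max_x g x).+1.
have gN x : g x < N by rewrite ltnS (leq_bigmax x).
have /fin_all_exists[f fP] := fun i : 'I_N => colg i.
exists (fun x => f (Ordinal (gN x)) x); split=> [x xS|x y xS yS xy].
  by apply: (fP _).1; rewrite !inE xS /=.
have gxy := gE x y xS yS xy.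
have ->: Ordinal (gN x) = Ordinal (gN y) by apply: val_inj.
by apply: (fP _).2 => //; rewrite !inE /= ?gxy ?xS ?yS /=.
Qed.

(** Greedy colouring by decreasing [pi]: the vertices of [O x] are coloured before [x] and, being
    fewer than [m], leave one of the [m] colours free. *)
Lemma degenerate_coloring (O : G -> {set G}) (pi : G -> nat) m :
    (forall x, #|O x| < m) -> (forall x y, y \in O x -> pi x < pi y) ->
  exists g : G -> nat, (forall x, g x < m) /\
    forall x y, y \in O x -> g x != g y.
Proof.
move=> Om Opi; pose N := (\max_x pi x).+1.
have piN x : pi x < N by rewrite ltnS (leq_bigmax x).
(* [n] counts the top levels of [pi] that are already coloured. *)
suff: forall n, exists g : G -> nat, forall x, N <= pi x + n ->
    g x < m /\ forall y, y \in O x -> g x != g y.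
  move/(_ N) => [g gP]; exists g; split=> [x|x]; have [] := gP x _ => //; lia.
elim=> [|n [g gP]].
  by exists (fun=> 0) => x; have := piN x; lia.
have fresh x : exists k, (k < m) && (k \notin [seq g y | y in O x]).
  have [[k km] /= kO|no] :=
      pickP [pred k : 'I_m | (k : nat) \notin [seq g y | y in O x]].
    by exists k; rewrite km.
  have: size (iota 0 m) <= size [seq g y | y in O x].
    apply: uniq_leq_size (iota_uniq _ _) _ => k; rewrite mem_iota add0n => /= km.
    by have /negbFE := no (Ordinal km).
  by rewrite size_iota size_image leqNgt Om.
exists (fun x => if N <= pi x + n then g x else xchoose (fresh x)) => x xN.
have yN y : y \in O x -> N <= pi y + n by move/Opi; lia.
case: ifP => [xn|_].
  have [gm gO] := gP x xn; split=> // y yO; rewrite (yN y yO); exact: gO.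
have /andP[km kO] := xchooseP (fresh x); split=> // y yO; rewrite (yN y yO).
by apply: contraNneq kO => ->; apply: image_f.
Qed.

(* [x] is the root of a tree with all vertices below [x] in [U], in which every
   vertex of depth less than [j] has at least [m] children and no vertex is
   adjacent to a proper ancestor other than its parent.  Children of distinct
   vertices need not be distinct. *)
Fixpoint good m j U x : bool :=
  if j is i.+1 then
    m <= #|[set w in U | adj x w && good m i (U :\: closed_nbh x) w]|
  else true.

Lemma good_sub m j U U' x : U \subset U' -> good m j U x -> good m j U' x.
Proof.
elim: j => //= j IH in U U' x * => sU /leq_trans; apply.
apply/subset_leq_card/subsetP=> w; rewrite !inE => /and3P[wU -> /=].
by rewrite (subsetP sU) //; apply/IH/setSD.
Qed.

(** The factor [m] counts the classes; in each, [k] colours serve the vertices with no lower-ranked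
    neighbour in the class, and the bound for [e] serves the others. *)
Fixpoint good_bound m k d :=
  if d is e.+1 then m * (k + good_bound m k e) else 0.

Lemma colorable_no_good m k d S (pi : G -> nat) :
    0 < m ->
    {in S, forall v, colorable_on (S :&: nbh v) k} ->
    (forall n, colorable_on (S :&: [set x | pi x == n]) k) ->
    {in S, forall x, ~~ good m d (S :&: [set y | pi x < pi y]) x} ->
  colorable_on S (good_bound m k d).
Proof.
move=> m_gt0; elim: d => [|d IH] in S pi * => Snbh Spi Sgood.
  (* At depth 0 every vertex is good, so [S] must be empty. *)
  suff ->: S = set0 by apply: colorable_on0.
  by apply/setP=> x; rewrite inE; apply/negP=> /Sgood.
pose later v := S :&: [set y | pi v < pi y].
pose O v := if v \in S then
    [set y in later v | adj v y && good m d (later v :\: closed_nbh v) y]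
  else set0.
have Om v : #|O v| < m.
  rewrite /O; case: ifP => [vS|_]; last by rewrite cards0.
  by have := Sgood v vS; rewrite -ltnNge.
have Opi v y : y \in O v -> pi v < pi y.
  by rewrite /O; case: ifP; rewrite !inE // => _ /andP[/andP[]].
have [g [gm gO]] := degenerate_coloring Om Opi.
apply: (colorable_on_classes (g := g)) => [//|i _].
set Si := S :&: _.
have sSi : Si \subset S by apply: subsetIl.
pose C := [set y in Si | [exists v in Si, adj v y && (pi v < pi y)]].
have CE y : y \in C = (y \in Si) && [exists v in Si, adj v y && (pi v < pi y)].
  by rewrite in_set.
have sCSi : C \subset Si by apply/subsetP=> y; rewrite CE => /andP[].
have sCS : C \subset S by apply: subset_trans sSi.
suff: colorable_on C (good_bound m k d).
  (* An edge outside [C] joins vertices of equal rank: otherwise its higher end would lie in [C]. *)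
  have B_col : colorable_on (Si :\: C) k.
    apply: (colorable_on_fibres (g := pi)) => [n|x y].
      by apply: colorable_on_sub (Spi n); apply/setSI/(subset_trans (subsetDl _ _)).
    rewrite !in_setD !CE => /andP[+ xSi] /andP[+ ySi] xy.
    rewrite xSi ySi /= => xC yC.
    have [lt_xy|lt_yx|//] := ltngtP (pi x) (pi y).
      by case/negP: yC; apply/existsP; exists x; rewrite xSi xy.
    by case/negP: xC; apply/existsP; exists y; rewrite ySi adj_sym xy.
  move=> C_col; apply: colorable_on_sub (colorable_onU B_col C_col).
  by apply/subsetP=> y ySi; rewrite in_setU in_setD ySi andbT orNb.
(* A linear order refining [pi]; vertices of [C] are then ranked by their first
   neighbour [p y] in the class, which has no neighbour of higher rank. *)
pose l v := pi v * #|G| + enum_rank v.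
have l_pi u v : l u <= l v -> pi u <= pi v.
  apply: contraTT; rewrite -!ltnNge => piuv.
  have: (pi v).+1 * #|G| <= pi u * #|G| by rewrite leq_mul2r piuv orbT.
  rewrite mulSn /l => le_uv; apply: leq_trans (leq_addr _ _).
  by apply: leq_trans le_uv; rewrite addnC ltn_add2r.
have l_inj : injective l.
  move=> u v luv; have piuv : pi u = pi v.
    by apply/eqP; rewrite eqn_leq !l_pi ?luv.
  by apply/enum_rank_inj/val_inj; move: luv; rewrite /l piuv => /addnI.
have /fin_all_exists[p pP] : forall y, exists v, y \in C ->
    [/\ v \in Si, adj v y, pi v < pi y
      & {in Si, forall u, adj u y -> l v <= l u}].
  move=> y; have [yC|_] := boolP (y \in C); last by exists y.
  have := yC; rewrite CE => /andP[ySi /existsP[v0 /and3P[v0S v0y piv0]]].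
  case: (@arg_minnP _ v0 [pred v | (v \in Si) && adj v y] l) => [|v].
    by rewrite /= v0S.
  move=> /andP[vS vy] vmin; exists v => _; split=> // [|u uS uy].
    by apply: leq_ltn_trans piv0; apply/l_pi/vmin; rewrite /= v0S.
  by apply: vmin; rewrite /= uS.
apply: (IH C (l \o p)) => [v vC|n|x xC].
- apply: colorable_on_sub (Snbh v (subsetP sCS _ vC)); exact: setSI.
- have [->|[y0 /setIP[y0C]]] := set_0Vmem (C :&: [set x | (l \o p) x == n]).
    exact: colorable_on0.
  rewrite inE /= => /eqP ln.
  have [pS _ _ _] := pP _ y0C.
  apply: colorable_on_sub (Snbh (p y0) (subsetP sSi _ pS)).
  apply/subsetP=> y /setIP[yC]; rewrite inE /= -ln => /eqP/l_inj pyE.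
  by have [_ py _ _] := pP _ yC; rewrite in_setI (subsetP sCS) // inE -pyE.
apply/negP=> xgood; have [vS vx pivx vmin] := pP _ xC.
have xS := subsetP sCS _ xC.
(* This gives [p x] and [x] different values of [g], although both lie in the class [Si]. *)
have /gO : x \in O (p x).
  rewrite /O (subsetP sSi _ vS) inE vx in_setI xS inE pivx /=.
  apply: good_sub xgood; apply/subsetP=> y /setIP[yC]; rewrite inE /= => lxy.
  have [uS uy piuy umin] := pP _ yC.
  have piy : pi (p x) < pi y by apply: leq_ltn_trans piuy; apply/l_pi/ltnW.
  rewrite in_setD in_setI (subsetP sCS _ yC) !inE piy !andbT negb_or.
  apply/andP; split; first by apply: contraTneq piy => ->; rewrite ltnn.
  (* If [p x] were adjacent to [y], minimality of [p y] would give [l (p y) <= l (p x)]. *)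
  by apply/negP=> /(umin _ vS); rewrite leqNgt lxy.
have /setIP[_] := vS; have /setIP[_] := subsetP sCSi _ xC.
by rewrite !inE => /eqP-> /eqP->; rewrite eqxx.
Qed.

End Colouring.

(** * Greedy embedding of the tree *)

Section Embedding.

Variables (T : sgraph) (r : T) (G : sgraph).
Implicit Types (A : {set T}) (phi : T -> G) (P : T -> seq T).

Definition sub_adj A : rel T := [rel x y | [&& adj x y, x \in A & y \in A]].

Lemma sub_adj_sym A : symmetric (sub_adj A).
Proof. by move=> x y; rewrite /sub_adj /= adj_sym [(x \in A) && _]andbC. Qed.

Lemma sub_adj_path A x p :
  x \in A -> path (sub_adj A) x p -> path (@adj T) x p /\ {subset p <= A}.
Proof.
elim: p x => [|y p IH] x //= xA /andP[/and3P[-> _ yA] /(IH _ yA)[-> sp]].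
by split=> // z; rewrite inE => /predU1P[->|/sp].
Qed.

Lemma connect_uniq_path A x y : x \in A -> connect (sub_adj A) x y ->
  exists p, [/\ path (@adj T) x p, uniq (x :: p), {subset x :: p <= A}
              & y = last x p].
Proof.
move=> xA /connectP[p0 pth0 ->]; case/shortenP: pth0 => p pth up _.
have [pth' sp] := sub_adj_path xA pth.
by exists p; split=> // z; rewrite inE => /predU1P[->|/sp].
Qed.

(** Two distinct neighbours of [b], joined by a path inside [A], would close a cycle through [b]. *)
Lemma acyclic_unique_nbh A (b a a' : T) : acyclic T ->
    {in A &, forall x y, connect (sub_adj A) x y} -> b \notin A ->
  a \in A -> a' \in A -> adj b a -> adj b a' -> a = a'.
Proof.
move=> acT conA bA aA a'A ba ba'.
have [p [pth up sp a'E]] := connect_uniq_path aA (conA a a' aA a'A).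
apply/eqP/negPn/negP=> neq_aa'.
have p_gt0 : 0 < size p.
  by case: p a'E {pth up sp} => //= /esym/eqP; rewrite (negPf neq_aa').
apply: (acT [:: b, a & p]) => //.
rewrite /ucycle /= rcons_path ba pth -a'E adj_sym ba' /=.
by move: up => /= ->; rewrite andbT; apply: contra bA => /sp.
Qed.

(* [P a] is the only path from [r] to [a] inside [A]; goodness of its last
   vertex, away from the earlier ones, is what lets [phi] be extended. *)
Record partial_copy A phi P := PartialCopy {
  pc_root : r \in A;
  pc_inj : {in A &, injective phi};
  pc_adj : {in A &, forall x y, adj x y -> adj (phi x) (phi y)};
  pc_conn : {in A, forall a, connect (sub_adj A) r a};
  pc_path : forall p, is_path r p -> {subset r :: p <= A} ->
    [/\ p = P (last r p),
        forall i j, i < j <= size p ->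
          adj (phi (nth r (r :: p) i)) (phi (nth r (r :: p) j)) -> j = i.+1
      & good #|T| (#|T| - size p)
          [set w | all (fun y => w \notin closed_nbh (phi y)) (belast r p)]
          (phi (last r p))] }.

Lemma partial_copy1 (x : G) :
  good #|T| #|T| setT x -> partial_copy [set r] (fun=> x) (fun=> [::]).
Proof.
move=> gx; split; first exact: set11.
- by move=> y z /set1P-> /set1P->.
- by move=> y z /set1P-> /set1P->; rewrite adj_irrefl.
- by move=> y /set1P->.
move=> [|y p] [pth up] sp.
  split=> //; first by move=> i j /andP[/leq_trans/[apply]].
  by rewrite subn0; apply: good_sub gx; apply/subsetP=> w; rewrite inE.
have /set1P yr : y \in [set r] by apply: sp; rewrite !inE eqxx orbT.
by move: up; rewrite yr /= inE eqxx.
Qed.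

(** The image of [A] has fewer than [#|T|] vertices, so it cannot exhaust the good children of
    [phi a]; a free child becomes the image of [b]. *)
Lemma partial_copy_extend A phi P (a b : T) :
    acyclic T -> partial_copy A phi P -> a \in A -> b \notin A -> adj a b ->
  exists phi' P', partial_copy (b |: A) phi' P'.
Proof.
move=> acT [rA inj adjA con pathA] aA bA ab.
have conA : {in A &, forall x y, connect (sub_adj A) x y}.
  move=> x y xA yA; apply: connect_trans (con y yA).
  by rewrite (sym_connect_sym (@sub_adj_sym A)) con.
have nbh_b c : c \in A -> adj b c -> c = a.
  by move=> cA bc; apply: (acyclic_unique_nbh acT conA bA) => //; rewrite adj_sym.
have [p [pth up sp aE]] := connect_uniq_path rA (con a aA).
have [pE pind pgood] := pathA p (conj pth up) sp.
(* Hence the goodness remaining at [phi a] has positive depth. *)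
have lt_p : size p < #|T| by have := card_uniqP up => /= <-; apply: max_card.
have [j jE] : exists j, #|T| - size p = j.+1.
  by exists (#|T| - size p).-1; rewrite prednK ?subn_gt0.
move: pgood; rewrite -aE jE /=; set U := [set w | all _ _]; set D := [set w in U | _].
move=> Dbig; have [w wD wA] : exists2 w, w \in D & w \notin phi @: A.
  apply/subsetPn; apply: contraL Dbig => /subset_leq_card leD.
  rewrite -ltnNge; apply: leq_ltn_trans leD _.
  apply: leq_ltn_trans (leq_imset_card _ _) _.
  by apply: proper_card; apply/properP; split; [apply/subsetP | exists b].
have /and3P[wU aw gw] : [&& w \in U, adj (phi a) w
    & good #|T| j (U :\: closed_nbh (phi a)) w] by rewrite inE in wD.
pose phi' x := if x == b then w else phi x.
have phiA x : x \in A -> phi' x = phi x.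
  by rewrite /phi'; case: eqP => // -> bA'; rewrite bA' in bA.
have phib : phi' b = w by rewrite /phi' eqxx.
have mapA q : {subset q <= A} -> map phi' q = map phi q.
  by move=> sq; apply/eq_in_map=> x /sq/phiA.
have wphi x : x \in A -> w != phi x.
  by move=> xA; apply: contraNneq wA => ->; apply: imset_f.
exists phi', (fun x => if x == b then rcons p b else P x); split.
- by rewrite inE rA orbT.
- move=> x y /setU1P[->|xA] /setU1P[->|yA] //; rewrite ?phib ?phiA //.
  + by move=> wE; case/eqP: (wphi y yA).
  + by move=> wE; case/eqP: (wphi x xA).
  + exact: inj.
- move=> x y /setU1P[->|xA] /setU1P[->|yA]; rewrite ?phib ?phiA ?adj_irrefl //.
  + by move=> /(nbh_b y yA)->; rewrite adj_sym.
  + by rewrite adj_sym => /(nbh_b x xA)->.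
  + exact: adjA.
- have sub x y : connect (sub_adj A) x y -> connect (sub_adj (b |: A)) x y.
    apply: connect_sub => {}x {}y /and3P[xy xA yA]; apply: connect1.
    by rewrite /sub_adj /= xy !inE xA yA !orbT.
  move=> x /setU1P[->|xA]; last exact/sub/con.
  apply: connect_trans (sub _ _ (con a aA)) _; apply: connect1.
  by rewrite /sub_adj /= ab !inE eqxx aA orbT.
have neq_rb : r != b by apply: contraNneq bA => <-.
move=> q [qpth uq] sq; have [bq|bq] := boolP (b \in q); last first.
  have sqA : {subset r :: q <= A}.
    move=> x xq; have /setU1P[xb|//] := sq x xq.
    by move: xq; rewrite xb inE eq_sym (negPf neq_rb) (negPf bq).
  have [qE qind qgood] := pathA q (conj qpth uq) sqA.
  have lA : last r q \in A by apply/sqA/mem_last.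
  have nthA i : nth r (r :: q) i \in A.
    have [lt_i|ge_i] := ltnP i (size (r :: q)); first exact/sqA/mem_nth.
    by rewrite nth_default.
  split=> [|i j' ij|]; first by rewrite (negPf (memPn bA _ lA)).
    by rewrite !phiA //; apply: qind.
  rewrite phiA //; apply: good_sub qgood; apply/subsetP=> z; rewrite !inE.
  move=> /allP zq; apply/allP=> y yq; rewrite phiA ?zq //.
  exact/sqA/mem_belast.
(* A path meeting [b] enters it from [a], its only neighbour in [A], and stops there, since going on
   would repeat [a] or [b]. So it is [rcons p b]. *)
move: qpth uq sq; case/splitPr: bq => q1 q2.
rewrite cat_path => /andP[q1pth lb_q2pth] uq sq.
have /andP[lb q2pth] := lb_q2pth.
have sq1 : {subset r :: q1 <= A}.
  move=> x xq1; have /setU1P[xb|//] : x \in b |: A.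
    by apply: sq; rewrite -cat_cons mem_cat xq1.
  move: uq; rewrite -cat_cons cat_uniq /= => /and3P[_ + _].
  by rewrite -xb xq1.
have lA : last r q1 \in A by apply/sq1/mem_last.
have laE : last r q1 = a by apply: nbh_b; rewrite // adj_sym.
have uq1 : uniq (r :: q1) by move: uq; rewrite -cat_cons cat_uniq => /andP[].
have q1E : q1 = p.
  by have [-> _ _] := pathA q1 (conj q1pth uq1) sq1; rewrite laE aE -pE.
have q2E : q2 = [::].
  case: q2 q2pth uq sq {lb_q2pth} => // c q2 bcpth uq sq; have /andP[bc _] := bcpth.
  move: uq; rewrite -cat_cons cat_uniq => /and3P[_ /norP[_ /norP[cq1 _]]].
  move=> /andP[/norP[neq_bc _] _].
  have /setU1P[cb|cA] : c \in b |: A.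
  - by apply: sq; rewrite -cat_cons mem_cat !inE eqxx !orbT.
  - by rewrite cb eqxx in neq_bc.
  by case/negP: cq1; rewrite (nbh_b c cA bc) -laE mem_last.
rewrite {}q2E {}q1E {q1 lb lb_q2pth q1pth uq1 sq1 lA laE q2pth uq sq q2} cats1.
have nthA i : nth r (r :: p) i \in A.
  have [lt_i|ge_i] := ltnP i (size (r :: p)); first exact/sp/mem_nth.
  by rewrite nth_default.
rewrite last_rcons eqxx size_rcons -rcons_cons phib; split=> //.
  move=> i j' /andP[lt_ij]; rewrite leq_eqVlt ltnS => /predU1P[j'E|le_j'].
    rewrite j'E !nth_rcons /= ltnn eqxx -j'E lt_ij phib phiA //.
    rewrite {}j'E ltnS leq_eqVlt in lt_ij *.
    case/predU1P: lt_ij => [->//|lt_i].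
    rewrite lastI nth_rcons size_belast lt_i.
    (* Membership in [U] keeps [w] away from the images of all path vertices before [a]. *)
    have := wU; rewrite inE => /allP/(_ (nth r (belast r p) i)).
    rewrite mem_nth ?size_belast // => /(_ isT).
    by rewrite !inE negb_or => /andP[_ /negPf->].
  rewrite !nth_rcons /= !ltnS le_j' (leq_trans (ltnW lt_ij) le_j') !phiA //.
  by apply: pind; rewrite lt_ij.
have ->: #|T| - (size p).+1 = j by rewrite subnS jE.
apply: good_sub gw; apply/subsetP=> z; rewrite belast_rcons in_setD !inE.
move=> /andP[za /allP zU]; apply/allP=> y; rewrite lastI mem_rcons inE.
move=> /predU1P[->|yp].
  by rewrite -aE phiA // !inE.
by rewrite phiA ?zU //; apply/sp/mem_belast.
Qed.

Lemma tree_embedding (x : G) : is_tree T -> good #|T| #|T| setT x ->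
  exists phi, path_induced_copy r phi.
Proof.
move=> [[_ conT] acT] gx.
have ext n : n < #|T| -> exists A phi P, partial_copy A phi P /\ #|A| = n.+1.
  elim: n => [_|n IH lt_n].
    exists [set r], (fun=> x), (fun=> [::]); rewrite cards1.
    by split=> //; apply: partial_copy1.
  have [A [phi [P [pcA cardA]]]] := IH (ltnW lt_n).
  have [a [b [aA bA ab]]] : exists a b, [/\ a \in A, b \notin A & adj a b].
    have [/existsP[a /andP[aA /existsP[b /andP[bA ab]]]]|noexit] :=
        boolP [exists a in A, [exists b, (b \notin A) && adj a b]].
      by exists a, b.
    (* With no edge leaving it, [A] would be all of [T] by connectedness, against its size. *)
    have clA y z : adj y z -> y \in A -> z \in A.
      move=> yz yA; apply: contraR noexit => zA.
      by apply/existsP; exists y; rewrite yA; apply/existsP; exists z; rewrite zA.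
    have cA : closed (@adj T) (mem A).
      by move=> y z yz; apply/idP/idP; apply: clA; rewrite // adj_sym.
    move: lt_n; rewrite -cardA ltnNge; case/negP; apply/subset_leq_card/subsetP.
    by move=> y _; rewrite -(closed_connect cA (conT r y)) /= (pc_root pcA).
  have [phi' [P' pc']] := partial_copy_extend acT pcA aA bA ab.
  by exists (b |: A), phi', P'; rewrite cardsU1 bA cardA.
have T_gt0 : 0 < #|T| by apply/card_gt0P; exists r.
have [|A [phi [P [[_ inj adjA _ pathA] cardA]]]] := ext #|T|.-1.
  by rewrite prednK.
have AT z : z \in A.
  suff ->: A = setT by rewrite inE.
  by apply/eqP; rewrite eqEcard subsetT cardsT cardA prednK /=.
exists phi; split=> [y z|y z|p [pth up]]; [exact: inj|exact: adjA|].
have [|_ pind _] := pathA p (conj pth up) => [z _ //|].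
split.
  split; last by rewrite -map_cons map_inj_uniq // => y z; apply: inj.
  by rewrite path_map; apply: sub_path pth => y z; apply: adjA.
move=> i j /=; rewrite size_map ltnS => ij.
rewrite -map_cons !(nth_map r) /= ?ltnS ?(leq_trans (ltnW (andP ij).1)) ?(andP ij).2 //.
exact: pind.
Qed.

End Embedding.

(** * Induction on the clique size *)

(** Working with subsets [S] of a fixed graph lets the induction on [t] reach neighbourhoods without
    forming induced subgraphs. *)
Lemma clique_free_colorable (T : sgraph) (r : T) (t : nat) :
  is_tree T ->
  exists C : nat, forall G : sgraph,
    ~ (exists phi : T -> G, path_induced_copy r phi) ->
    forall S : {set G},
    ~ (exists A : {set G}, [/\ A \subset S, is_clique A & #|A| = t]) ->
    colorable_on S C.
Proof.
move=> hT; elim: t => [|t [C IH]].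
  exists 0 => G _ S []; exists set0; rewrite sub0set cards0; split=> // x y.
  by rewrite inE.
(* The ranking by [enum_rank] has fibres of at most one vertex; [C.+1] provides a colour for them
   even when [C] is 0. *)
exists (good_bound #|T| C.+1 #|T|) => G noT S noK.
apply: (colorable_no_good (pi := fun x => enum_rank x)) => [|v vS|n|x xS].
- by apply/card_gt0P; exists r.
- have : colorable_on (S :&: nbh v) C.
    apply: IH noT _ _ => [[A [/subsetP sA clA cardA]]]; case: noK.
    exists (v |: A); split.
    + by apply/subsetP=> x /setU1P[->//|/sA/setIP[]].
    + move=> x y /setU1P[->|xA] /setU1P[->|yA] neq_xy.
      * by rewrite eqxx in neq_xy.
      * by have /setIP[_] := sA _ yA; rewrite inE.
      * by have /setIP[_] := sA _ xA; rewrite inE adj_sym.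
      * exact: clA.
    rewrite cardsU1 cardA; case: (boolP (v \in A)) => // /sA/setIP[_].
    by rewrite inE adj_irrefl.
  by move=> [f [fC fP]]; exists f; split=> // x /fC/ltnW.
- exists (fun=> 0); split=> // x y; rewrite !in_setI ![_ \in [set _ | _]]inE.
  move=> /andP[_ /eqP xn] /andP[_ /eqP yn].
  by rewrite (enum_rank_inj (val_inj (etrans xn (esym yn)))) adj_irrefl.
by apply/negP=> /(good_sub (subsetT _)) gx; apply: noT; exact: tree_embedding hT gx.
Qed.

Theorem mainTheorem1 (T : sgraph) (hT : is_tree T) (r : T) (t : nat)
    (ht : 1 <= t) :
  exists C : nat, forall G : sgraph,
    ~ (exists phi : T -> G, path_induced_copy r phi) ->
    ~ (exists A : {set G}, is_clique A /\ #|A| = t) ->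
    chromatic_number G <= C.
Proof.
have [C colC] := clique_free_colorable r t hT.
exists C => G noT noK.
have [|f [fC fP]] := colC G noT setT.
  by move=> [A [_ clA cardA]]; apply: noK; exists A.
rewrite /chromatic_number; case: ex_minnP => k _; apply.
apply/existsP; exists [ffun x => Ordinal (fC x (in_setT x))].
apply/forallP=> x; apply/forallP=> y; apply/implyP=> xy; rewrite !ffunE.
by rewrite -val_eqE /= fP ?inE.
Qed.
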